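(* Let $K$ be an arbitrary field and let $p(s)=s^n+a_{n-1}s^{n-1}+\dots+a_0\in K[s]$ be a monic irreducible polynomial of degree $n$. Let $k\ge 1$ be an integer, and let $h\in K^q[s]$ and $g\in K^t[s]$ be polynomial vectors such that \[ W=h\,\frac{1}{p^k}\,g^T\in K^{q\times t}(s) \] is a coprime factorization. Write the $p$-adic expansions \[ h=h_0+h_1p+h_2p^2+\cdots,\qquad g=g_0+g_1p+g_2p^2+\cdots, \] where $h_i\in K^q[s]$, $g_i\in K^t[s]$ and every nonzero component of $h_i$ and of $g_i$ has degree $<n$. Let $b(s)=(1,s,\dots,s^{n-1})^T$. For each $i\ge 0$ define $H_i\in K^{q\times n}$ by $h_i(s)=H_i\,b(s)$, and define $G_i\in K^{t\times n}$ by $g_i(s)=G_i\,M\,b(s)$, where $M=M(p)$ is the $n\times n$ Hankel matrix defined in the context. Put \[ H=(H_0,H_1,\dots,H_{k-1})\in K^{q\times nk},\qquad G=\begin{pmatrix}G_{k-1}^T\\ \vdots\\ G_0^T\end{pmatrix}\in K^{nk\times t}. \] Then \[ \pi_-W=H\bigl(sI-J(p^k)\bigr)^{-1}G, \] and this realization is minimal, i.e. there is no triple $(F',G',H')$ with $F'$ square of size less than $nk$ and $H'(sI-F')^{-1}G'=\pi_-W$.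
   Context: $K(s)$ denotes the field of rational functions over $K$. A rational function $f$ is strictly proper if $f=0$ or $f=g/h$ with $g,h\in K[s]$, $gh\neq 0$, $\deg g<\deg h$. Every $f\in K(s)$ decomposes uniquely as $f=w+y$ with $w$ strictly proper and $y\in K[s]$; one sets $\pi_-f=w$, and $\pi_-$ is applied entrywise to vectors and matrices. The factorization $W=h\,p^{-k}\,g^T$ is called coprime if $h$ and $p^k$ are right coprime and $p^k$ and $g^T$ are left coprime; concretely, $p$ and the entries of $h$ have no nonconstant common factor, and $p$ and the entries of $g$ have no nonconstant common factor. The companion matrix of $p$ is the $n\times n$ matrix $C=C(p)$ with ones on the superdiagonal (entries $(i,i+1)$, $i=1,\dots,n-1$), last row $(-a_0,-a_1,\dots,-a_{n-1})$, and zeros elsewhere (if $n=1$, $p=s-\lambda$, then $C=(\lambda)$). Let $V=e_ne_1^T$ be the $n\times n$ matrix whose only nonzero entry is a $1$ in position $(n,1)$. Let $N_k$ be the $k\times k$ matrix with ones on the superdiagonal and zeros elsewhere. The Jacobson block of $p^k$ is the $nk\times nk$ block upper bidiagonal matrix \[ J(p^k)=I_k\otimes C+N_k\otimes V, \] i.e. $C$ in every diagonal block, $V$ in every block immediately above the diagonal, and zero blocks elsewhere; here $\otimes$ is the Kronecker product $A\otimes B=(a_{ij}B)$. $M=M(p)$ is the $n\times n$ matrix whose $(i,j)$ entry is $a_{i+j-1}$ if $i+j-1\le n-1$, equals $1$ if $i+j-1=n$, and equals $0$ if $i+j-1>n$; i.e. first row $(a_1,a_2,\dots,a_{n-1},1)$,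 second row $(a_2,\dots,a_{n-1},1,0)$, ..., last row $(1,0,\dots,0)$ (for $n=1$, $M=(1)$). $M$ is invertible, so $G_i$ is uniquely determined. *)

(* Defs.v *)
From HB Require Import structures.
From mathcomp Require Import all_boot all_order all_algebra.
From mathcomp Require Import fraction.
Set Implicit Arguments. Unset Strict Implicit. Unset Printing Implicit Defensive.
Import Order.TTheory GRing.Theory Num.Theory.
Local Open Scope ring_scope.

Lemma blk_div_lt (m n : nat) (i : 'I_(m * n)) : (i %/ n < m)%N.
Proof.
case: n i => [|n] i; first by case: i => i; rewrite muln0.
by rewrite ltn_divLR // ltn_ord.
Qed.
Lemma blk_mod_lt (m n : nat) (i : 'I_(m * n)) : (i %% n < n)%N.
Proof.
case: n i => [|n] i; first by case: i => i; rewrite muln0.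
by rewrite ltn_mod.
Qed.
Definition blk_div m n (i : 'I_(m * n)) : 'I_m := Ordinal (blk_div_lt i).
Definition blk_mod m n (i : 'I_(m * n)) : 'I_n := Ordinal (blk_mod_lt i).

Definition kron (R : pzRingType) m1 n1 m2 n2 (A : 'M[R]_(m1, n1)) (B : 'M[R]_(m2, n2))
  : 'M[R]_(m1 * m2, n1 * n2) :=
  \matrix_(i, j) (A (blk_div i) (blk_div j) * B (blk_mod i) (blk_mod j)).

Section Defs.
Variable K : fieldType.

Local Notation RF := {fraction {poly K}}.

Definition cst (c : K) : RF := tofrac (c%:P).
Definition polF (x : {poly K}) : RF := tofrac x.
Definition svar : RF := tofrac ('X : {poly K}).

Definition strictly_proper (f : RF) : Prop :=
  f = 0 \/ exists a b : {poly K}, a * b != 0 /\ (size a < size b)%N /\ f = tofrac a / tofrac b.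

(* pim f w  <->  w = pi_- f  (the unique decomposition f = w + y, w strictly
   proper, y polynomial) *)
Definition pim (f w : RF) : Prop :=
  strictly_proper w /\ exists y : {poly K}, f = w + tofrac y.

Definition pim_mx m n (F Wm : 'M[RF]_(m, n)) : Prop :=
  forall i j, pim (F i j) (Wm i j).

Definition companion (n : nat) (p : {poly K}) : 'M[K]_n :=
  \matrix_(i, j) (if (i : nat) == n.-1 then - p`_j else ((i.+1 == j)%N)%:R).

Definition Vmx (n : nat) : 'M[K]_n :=
  \matrix_(i, j) ((((i : nat) == n.-1) && ((j : nat) == 0%N))%:R).

Definition Nmx (k : nat) : 'M[K]_k := \matrix_(i, j) ((i.+1 == j)%N%:R).

Definition jacobson (n k : nat) (p : {poly K}) : 'M[K]_(k * n) :=
  kron (1%:M : 'M[K]_k) (companion n p) + kron (Nmx k) (Vmx n).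

Definition hankelM (n : nat) (p : {poly K}) : 'M[K]_n :=
  \matrix_(i, j) (let l := (i + j + 1)%N in
                  if (l <= n.-1)%N then p`_l else if l == n then 1 else 0).

Definition bvec (n : nat) : 'cV[{poly K}]_n := \col_i 'X^i.

Definition coprime_vec (q : nat) (p : {poly K}) (h : 'cV[{poly K}]_q) : Prop :=
  forall d : {poly K}, d %| p -> (forall r, d %| h r ord0) -> (size d <= 1)%N.

Definition padic_exp (q n : nat) (p : {poly K}) (h : 'cV[{poly K}]_q)
  (hs : nat -> 'cV[{poly K}]_q) : Prop :=
  (forall i r, (size (hs i r ord0) <= n)%N) /\
  exists N : nat, (forall i, (N <= i)%N -> hs i = 0) /\
                  h = \sum_(i < N) p ^+ i *: hs i.

Definition Hblock (q n k : nat) (Hs : nat -> 'M[K]_(q, n)) : 'M[K]_(q, k * n) :=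
  \matrix_(r, j) Hs (blk_div j : nat) r (blk_mod j).

Definition Gblock (t n k : nat) (Gs : nat -> 'M[K]_(t, n)) : 'M[K]_(k * n, t) :=
  \matrix_(j, c) Gs (k.-1 - blk_div j)%N c (blk_mod j).

Definition transfer (q t m : nat) (F : 'M[K]_m) (G : 'M[K]_(m, t)) (H : 'M[K]_(q, m))
  : 'M[RF]_(q, t) :=
  map_mx cst H *m invmx (svar%:M - map_mx cst F) *m map_mx cst G.

Definition Wmx (q t k : nat) (p : {poly K}) (h : 'cV[{poly K}]_q) (g : 'cV[{poly K}]_t)
  : 'M[RF]_(q, t) :=
  (polF (p ^+ k))^-1 *: (map_mx polF h *m (map_mx polF g)^T).

End Defs.

(* Main.v *)
(** Let D = sI - J(p^k), B = (b, pb, ..., p^(k-1) b)^T and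
    C = (p^(k-1) (Mb)^T, ..., p (Mb)^T, (Mb)^T).  Then D B = p^k e_last and
    C D = p^k e_first, while h = H B and g^T = C G modulo p^k.  Hence
    (e_last C - 1) D = D (B e_first - 1); since J is Hessenberg with ones on the
    superdiagonal and the last column of e_last C - 1 vanishes, e_last C - 1 = D Y
    for a polynomial matrix Y.  So B C / p^k = D^-1 + Y, and W and H D^-1 G differ
    by a polynomial matrix.  For minimality, if F realizes the strictly proper part
    of W then p^k divides det(sI - F) h_r g_c for all r and c; coprimality provides
    h_r and g_c not divisible by p, so p^k divides det(sI - F). *)
Require Import Defs.
From HB Require Import structures.
From mathcomp Require Import all_boot all_order all_algebra.
From mathcomp Require Import fraction zify.
Import GRing.Theory.
Local Open Scope ring_scope.

Set Implicit Arguments. Unset Strict Implicit. Unset Printing Implicit Defensive.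

(** * Kronecker products and block indices *)

Lemma sum_blk (V : nmodType) m n (F : 'I_m -> 'I_n -> V) :
  \sum_(a < m * n) F (blk_div a) (blk_mod a) = \sum_i \sum_j F i j.
Proof.
rewrite pair_big /=; symmetry.
rewrite (reindex (fun a : 'I_(m * n) => (blk_div a, blk_mod a))) //=.
(* Injectivity is uniqueness in Euclidean division by [n]; equal cardinalities do the rest. *)
apply/onW_bij/inj_card_bij; last by rewrite card_prod !card_ord.
move=> a b [e1 e2]; apply: val_inj.
by rewrite /= (divn_eq a n) (divn_eq b n) e1 e2.
Qed.

Lemma kron_mul (R : comPzRingType) m1 n1 l1 m2 n2 l2
    (A : 'M[R]_(m1, n1)) (B : 'M[R]_(m2, n2))
    (C : 'M[R]_(n1, l1)) (D : 'M[R]_(n2, l2)) :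
  kron A B *m kron C D = kron (A *m C) (B *m D).
Proof.
apply/matrixP=> i j; rewrite !mxE.
under eq_bigr do rewrite !mxE.
rewrite (sum_blk (fun a b => A (blk_div i) a * B (blk_mod i) b *
                             (C a (blk_div j) * D b (blk_mod j)))).
rewrite big_distrl; apply: eq_bigr => a _ /=.
rewrite big_distrr; apply: eq_bigr => b _ /=.
exact: mulrACA.
Qed.

Lemma kronBl (R : pzRingType) m1 n1 m2 n2 (A A' : 'M[R]_(m1, n1)) (B : 'M[R]_(m2, n2)) :
  kron (A - A') B = kron A B - kron A' B.
Proof. by apply/matrixP=> i j; rewrite !mxE mulrBl. Qed.

Lemma kronBr (R : pzRingType) m1 n1 m2 n2 (A : 'M[R]_(m1, n1)) (B B' : 'M[R]_(m2, n2)) :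
  kron A (B - B') = kron A B - kron A B'.
Proof. by apply/matrixP=> i j; rewrite !mxE mulrBr. Qed.

Lemma kronZl (R : pzRingType) m1 n1 m2 n2 x (A : 'M[R]_(m1, n1)) (B : 'M[R]_(m2, n2)) :
  kron (x *: A) B = x *: kron A B.
Proof. by apply/matrixP=> i j; rewrite !mxE mulrA. Qed.

Lemma kronZr (R : comPzRingType) m1 n1 m2 n2 x (A : 'M[R]_(m1, n1)) (B : 'M[R]_(m2, n2)) :
  kron A (x *: B) = x *: kron A B.
Proof. by apply/matrixP=> i j; rewrite !mxE mulrCA. Qed.

Lemma map_kron (R S : pzRingType) (f : {rmorphism R -> S}) m1 n1 m2 n2
    (A : 'M[R]_(m1, n1)) (B : 'M[R]_(m2, n2)) :
  map_mx f (kron A B) = kron (map_mx f A) (map_mx f B).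
Proof. by apply/matrixP=> i j; rewrite !mxE rmorphM. Qed.

(** Counting in base [n]: the last digit either wraps to zero with a carry or increases. It locates
    the superdiagonal of a block matrix. *)
Lemma divmod_succ n qa ra qb rb : (ra < n)%N -> (rb < n)%N ->
  (qb * n + rb = (qa * n + ra).+1)%N ->
  if ra == n.-1 then qb = qa.+1 /\ rb = 0%N else qb = qa /\ rb = ra.+1.
Proof.
move=> lt_ra lt_rb eq_ab.
have mono (x y : nat) : (x <= y)%N -> (x * n <= y * n)%N by rewrite leq_mul2r orbC => ->.
have := mono qa qb; have := mono qb qa; have := mono qa.+1 qb; have := mono qb qa.+1.
have := mono qa.+2 qb; have := mono qb.+1 qa; rewrite !mulSn.
by case: eqP => ?; split; lia.
Qed.

Lemma div_eq_divD (L : fieldType) (a b x d y : L) : b != 0 -> d != 0 ->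
  (a / b == x / d + y) = (d * a == b * (x + d * y)).
Proof.
move=> b0 d0; have -> : x / d + y = (x + d * y) / d.
  by rewrite mulrDl mulrAC divff ?mul1r.
by rewrite eqr_div // [a * d]mulrC [_ * b]mulrC.
Qed.

Section Realization.
Variable K : fieldType.
Implicit Types (p d x y a b : {poly K}).

(** * The companion matrix, the Hankel matrix and Horner quotients *)

Lemma coef_monic n p : p \is monic -> size p = n.+1 -> p`_n = 1.
Proof. by move=> /monicP <- ps; rewrite lead_coefE ps. Qed.

Lemma drop_poly_monic n p : p \is monic -> size p = n.+1 -> drop_poly n p = 1.
Proof.
move=> pm ps; apply/polyP=> i; rewrite coef_drop_poly coef1; case: i => [|i].
  exact: coef_monic pm ps.
by rewrite nth_default // ps addSn ltnS leq_addl.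
Qed.

(** The three cases defining [hankelM] merge: the entry 1 is the leading coefficient, and
    coefficients beyond the degree vanish. *)
Lemma hankelM_coef n p : p \is monic -> size p = n.+1 ->
  forall i j : 'I_n, hankelM n p i j = p`_(i + j + 1).
Proof.
move=> pm ps i j; rewrite mxE /=; case: n ps i j => [|n] ps; first by case.
move=> i j; case: leqP => // le_n; case: eqP => [->|/eqP ne].
  by rewrite (coef_monic pm ps).
by rewrite nth_default // ps ltn_neqAle eq_sym ne.
Qed.

Lemma hankelM_bvec n p : p \is monic -> size p = n.+1 ->
  map_mx polyC (hankelM n p) *m bvec K n = \col_i drop_poly i.+1 p.
Proof.
move=> pm ps; apply/colP=> i; rewrite !mxE.
under eq_bigr do rewrite mxE hankelM_coef // mxE mul_polyC.
rewrite -(poly_def n (fun j => p`_(i + j + 1))); apply/polyP=> j.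
rewrite coef_poly coef_drop_poly addn1 addnS addnC.
by case: ltnP => // le_nj; rewrite nth_default // ps ltnS (leq_trans le_nj) ?leq_addr.
Qed.

Lemma drop_polyS i p : drop_poly i p = 'X * drop_poly i.+1 p + (p`_i)%:P.
Proof.
apply/polyP=> j; rewrite coefD coefXM coefC !coef_drop_poly.
by case: j => [|j]; rewrite ?add0r // addr0 /= addnS.
Qed.

Lemma companion_bvec n p : p \is monic -> size p = n.+2 ->
  map_mx polyC (companion n.+1 p) *m bvec K n.+1
  = 'X *: bvec K n.+1 - p *: delta_mx ord_max 0.
Proof.
move=> pm ps; apply/colP=> i; rewrite !mxE andbT -val_eqE /=.
under eq_bigr do rewrite !mxE /=.
case: eqP => [-> | /eqP ne].
  have def_p : p = \sum_(j < n.+1) p`_j *: 'X^j + 'X^(n.+1).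
    have := coefK p; rewrite poly_def ps big_ord_recr /=.
    by rewrite (coef_monic pm ps) scale1r.
  rewrite mulr1 {2}def_p -exprS opprD addrCA subrr addr0 -sumrN.
  by apply: eq_bigr => j _; rewrite polyCN mulNr mul_polyC.
rewrite mulr0 subr0.
have lt_i : (i.+1 < n.+1)%N by rewrite ltnS ltn_neqAle ne -ltnS ltn_ord.
rewrite (bigD1 (Ordinal lt_i)) //= eqxx mul1r -exprS big1 ?addr0 // => j.
by rewrite -val_eqE eq_sym /= => /negbTE->; rewrite mul0r.
Qed.

Lemma Vmx_bvec n :
  map_mx polyC (Vmx K n.+1) *m bvec K n.+1 = delta_mx ord_max 0.
Proof.
apply/colP=> i; rewrite !mxE andbT -val_eqE /=.
rewrite (bigD1 ord0) //= !mxE eqxx andbT expr0 mulr1 rmorph_nat big1 ?addr0 // => j.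
by rewrite !mxE -val_eqE /= => /negbTE->; rewrite andbF mul0r.
Qed.

(* Since [p] is monic of degree [n], its transpose is [M(p) b]; see [hankelM_bvec]. *)
Definition horner_row n p : 'rV[{poly K}]_n := \row_i drop_poly i.+1 p.

(** Column [j] picks up [drop_poly j p] from the superdiagonal and minus the coefficient of index
    [j] from the last row; [drop_polyS] combines them. Column 0 has no superdiagonal entry, hence
    the defect [p]. *)
Lemma horner_row_companion n p : p \is monic -> size p = n.+2 ->
  horner_row n.+1 p *m map_mx polyC (companion n.+1 p)
  = 'X *: horner_row n.+1 p - p *: delta_mx 0 ord0.
Proof.
move=> pm ps; apply/rowP=> j; rewrite !mxE /= -val_eqE /=.
under eq_bigr do rewrite !mxE /=.
rewrite (bigD1 ord_max) //= eqxx drop_poly_monic // mul1r.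
case: j => [[|j] lt_j] /=.
  rewrite mulr1 -[X in _ - X]drop_poly0l (drop_polyS 0) opprD addrA subrr add0r.
  rewrite big1 ?addr0 ?polyCN // => i; rewrite -val_eqE /= => /negbTE->.
  by rewrite mulr0.
rewrite mulr0 subr0 (bigD1 (Ordinal (ltnW lt_j))) /=; last first.
  by rewrite -val_eqE /= neq_ltn -ltnS lt_j.
rewrite eqxx ltn_eqF // mulr1 (drop_polyS j.+1) big1 ?addr0.
  by rewrite polyCN addrCA addNr addr0.
move=> i; rewrite -!val_eqE /= => /andP[/negbTE-> /negbTE ne].
by rewrite eqSS ne mulr0.
Qed.

(** * The Jacobson block and its two polynomial vectors *)

Lemma map_jacobson n k p :
  map_mx polyC (jacobson n k p)
  = kron 1%:M (map_mx polyC (companion n p))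
    + kron (map_mx polyC (Nmx K k)) (map_mx polyC (Vmx K n)).
Proof. by rewrite map_mxD !map_kron map_mx1. Qed.

Definition pow_col k p : 'cV[{poly K}]_k := \col_i p ^+ i.
(** The exponents decrease to match the order of the blocks in [Gblock]. *)
Definition rev_pow_row k p : 'rV[{poly K}]_k := \row_i p ^+ (k.-1 - i).

Lemma Nmx_pow_col k p :
  map_mx polyC (Nmx K k.+1) *m pow_col k.+1 p
  = p *: pow_col k.+1 p - p ^+ k.+1 *: delta_mx ord_max 0.
Proof.
apply/colP=> i; rewrite !mxE andbT -val_eqE /=.
under eq_bigr do rewrite !mxE /= rmorph_nat.
case: eqP => [-> | /eqP ne].
  rewrite mulr1 -exprS subrr big1 // => j _.
  by rewrite eq_sym ltn_eqF ?mul0r.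
rewrite mulr0 subr0.
have lt_i : (i.+1 < k.+1)%N by rewrite ltnS ltn_neqAle ne -ltnS ltn_ord.
rewrite (bigD1 (Ordinal lt_i)) //= eqxx mul1r -exprS big1 ?addr0 // => j.
by rewrite -val_eqE eq_sym /= => /negbTE->; rewrite mul0r.
Qed.

Lemma rev_pow_row_Nmx k p :
  rev_pow_row k.+1 p *m map_mx polyC (Nmx K k.+1)
  = p *: rev_pow_row k.+1 p - p ^+ k.+1 *: delta_mx 0 ord0.
Proof.
apply/rowP=> j; rewrite !mxE /= -val_eqE /=.
under eq_bigr do rewrite !mxE /= rmorph_nat.
case: j => [[|j] lt_j] /=.
  by rewrite mulr1 subn0 -exprS subrr big1 // => i _; rewrite mulr0.
rewrite mulr0 subr0 (bigD1 (Ordinal (ltnW lt_j))) //= eqxx mulr1 -exprS.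
rewrite -subSn // subSS big1 ?addr0 // => i.
by rewrite -val_eqE /= eqSS => /negbTE->; rewrite mulr0.
Qed.

Lemma horner_row_Vmx n p : p \is monic -> size p = n.+2 ->
  horner_row n.+1 p *m map_mx polyC (Vmx K n.+1) = delta_mx 0 ord0.
Proof.
move=> pm ps; apply/rowP=> j; rewrite !mxE /= -val_eqE /=.
rewrite (bigD1 ord_max) //= !mxE eqxx drop_poly_monic // mul1r rmorph_nat.
rewrite big1 ?addr0 // => i; rewrite !mxE -val_eqE /= => /negbTE->.
by rewrite mulr0.
Qed.

(** These are B and C of the overview; in Kronecker form [kron_mul] applies to them factor by
    factor. *)
Definition state_col n k p := kron (pow_col k p) (bvec K n).
Definition state_row n k p := kron (rev_pow_row k p) (horner_row n p).

(** The companion blocks leave a defect [p] in the last row of each block; the coupling by [Vmx]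
    cancels it everywhere but in the last block. *)
Lemma char_poly_mx_state_col n k p : p \is monic -> size p = n.+2 ->
  char_poly_mx (jacobson n.+1 k.+1 p) *m state_col n.+1 k.+1 p
  = p ^+ k.+1 *: kron (delta_mx ord_max 0 : 'cV_k.+1) (delta_mx ord_max 0 : 'cV_n.+1).
Proof.
move=> pm ps; rewrite /char_poly_mx mulmxBl mul_scalar_mx map_jacobson mulmxDl.
rewrite /state_col !kron_mul mul1mx companion_bvec // Nmx_pow_col Vmx_bvec.
by rewrite kronBr kronBl !kronZl !kronZr addrA subrK opprB addrC subrK.
Qed.

Lemma state_row_char_poly_mx n k p : p \is monic -> size p = n.+2 ->
  state_row n.+1 k.+1 p *m char_poly_mx (jacobson n.+1 k.+1 p)
  = p ^+ k.+1 *: kron (delta_mx 0 ord0 : 'rV_k.+1) (delta_mx 0 ord0 : 'rV_n.+1).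
Proof.
move=> pm ps; rewrite /char_poly_mx mulmxBr mul_mx_scalar map_jacobson mulmxDr.
rewrite /state_row !kron_mul mulmx1 horner_row_companion //
  rev_pow_row_Nmx horner_row_Vmx //.
by rewrite kronBr kronBl !kronZl !kronZr addrA subrK opprB addrC subrK.
Qed.

(** * Divisibility by a Hessenberg characteristic matrix *)

(* The columns of [sI - J] express column [j] of [Q], modulo the image of
   [sI - J], through columns of larger index. *)
Lemma hessenberg_div N (J : 'M[K]_N) (Q Z : 'M[{poly K}]_N) :
  (forall i j : 'I_N, i.+1 = j -> J i j = 1) ->
  (forall i j : 'I_N, (i.+1 < j)%N -> J i j = 0) ->
  Q *m char_poly_mx J = char_poly_mx J *m Z ->
  (forall j : 'I_N, j.+1 = N -> exists y : 'cV_N, col j Q = char_poly_mx J *m y) ->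
  exists Y, Q = char_poly_mx J *m Y.
Proof.
set D := char_poly_mx J => J1 J0 QD lastQ.
suff colQ j : exists y : 'cV_N, col j Q = D *m y.
  have [Y QY] := fin_all_exists colQ.
  exists (\matrix_(i, j) Y j i 0); apply/matrixP=> i j.
  have /colP/(_ i) := QY j; rewrite !mxE => ->.
  by apply: eq_bigr => l _; rewrite !mxE.
(* Downward induction on the column index [j]. *)
have [m] := ubnP (N - j); elim: m j => // m IH j lt_m.
have [|ne] := eqVneq j.+1 N; first exact: lastQ.
have lt_j : (j.+1 < N)%N by rewrite ltn_neqAle ne ltn_ord.
pose j' := Ordinal lt_j.
(* With the bound on [i] moved under the existential, with dummy value 0, a solution can be chosen
   for all [i] at once. *)
have {}IH (i : 'I_N) : exists y : 'cV_N, (j < i)%N -> col i Q = D *m y.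
  have [lt_ji|] := ltnP j i; last by exists 0.
  have [|y ->] := IH i; last by exists y.
  by have := ltn_ord i; lia.
have [y Qy] := fin_all_exists IH.
(* Column [j'] of [Q *m D] involves only columns of [Q] of index at least [j], and column [j] with
   coefficient -1, so it can be solved for column [j]. *)
exists ('X *: y j' - col j' Z - \sum_(i : 'I_N | (j < i)%N) (J i j')%:P *: y i).
have -> : col j Q =
  'X *: col j' Q - D *m col j' Z - \sum_(i : 'I_N | (j < i)%N) (J i j')%:P *: col i Q.
  have -> : D *m col j' Z = col j' (Q *m D) by rewrite QD !colE mulmxA.
  rewrite /D mulmxBr mul_mx_scalar; apply/colP=> r; rewrite !mxE summxE.
  rewrite opprB addrCA addrC subrr addr0 addrC.
  rewrite (bigD1 j) //= mxE J1 // mulr1 (bigID (fun i : 'I_N => j < i)%N) /=.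
  rewrite [X in _ + (_ + X)]big1 => [|i /andP[ne_ij]]; last first.
    rewrite -leqNgt leq_eqVlt val_eqE (negbTE ne_ij) => lt_ij; by rewrite mxE J0 ?mulr0.
  rewrite addr0 (eq_bigl (fun i : 'I_N => j < i)%N); last first.
    by move=> i /=; case: ltngtP; rewrite ?andbF //= -val_eqE /=; lia.
  rewrite (eq_bigr (fun i => ((J i j')%:P *: col i Q) r 0)) ?addrK // => i _.
  by rewrite !mxE mulrC.
rewrite !mulmxBr -scalemxAr -Qy // mulmx_sumr; congr (_ - _).
by apply: eq_bigr => i lt_ji; rewrite -scalemxAr Qy.
Qed.

(** Inside a diagonal block the 1 comes from the companion matrix; across a block boundary it is the
    single entry of [Vmx]. *)
Lemma jacobson_superdiag n k p (a b : 'I_(k * n)) : a.+1 = b -> jacobson n k p a b = 1.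
Proof.
have:= blk_mod_lt a; have:= blk_mod_lt b.
rewrite !mxE -val_eqE /=; have := divn_eq a n; have := divn_eq b n.
move: (a %/ n)%N (a %% n)%N (b %/ n)%N (b %% n)%N => qa ra qb rb -> -> lt_rb lt_ra.
move=> eq_ab; have := divmod_succ lt_ra lt_rb (esym eq_ab).
case: (eqVneq ra n.-1) => [ra_max | ra_lt] [-> ->]; last by rewrite !eqxx mulr1 mulr0 addr0.
by rewrite ltn_eqF // mul0r add0r eqxx mulr1.
Qed.

Lemma jacobson_above_superdiag n k p (a b : 'I_(k * n)) :
  (a.+1 < b)%N -> jacobson n k p a b = 0.
Proof.
have:= blk_mod_lt a; have:= blk_mod_lt b.
rewrite !mxE -val_eqE /=; have := divn_eq a n; have := divn_eq b n.
move: (a %/ n)%N (a %% n)%N (b %/ n)%N (b %% n)%N => qa ra qb rb -> -> lt_rb lt_ra lt_ab.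
have [eq_q | ne_q] := eqVneq qa qb.
  rewrite -eq_q -addnS ltn_add2l in lt_ab.
  rewrite mul1r [qa.+1 == qb]gtn_eqF ?eq_q // mul0r addr0.
  by rewrite ifN ?ltn_eqF //; apply/eqP; lia.
rewrite mul0r add0r; have [eq_q | ne_q'] := eqVneq qa.+1 qb; last by rewrite mul0r.
rewrite mul1r; case: eqP => // ra_max; case: eqP => // rb0.
by move: lt_ab; rewrite -eq_q mulSn; lia.
Qed.

(* Denominators cleared, this says that [state_col *m state_row / p ^+ k] and
   the resolvent of the Jacobson block differ by the polynomial matrix [Y]. *)
Lemma state_col_row n k p : p \is monic -> size p = n.+2 ->
  exists Y : 'M[{poly K}]_(k.+1 * n.+1),
  \det (char_poly_mx (jacobson n.+1 k.+1 p)) *: (state_col n.+1 k.+1 p *m state_row n.+1 k.+1 p)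
  = p ^+ k.+1 *: (\adj (char_poly_mx (jacobson n.+1 k.+1 p))
                  + \det (char_poly_mx (jacobson n.+1 k.+1 p)) *: Y).
Proof.
move=> pm ps; set D := char_poly_mx _.
set B := state_col _ _ _; set C := state_row _ _ _.
set e := kron (delta_mx ord_max 0 : 'cV[{poly K}]_k.+1) (delta_mx ord_max 0 : 'cV_n.+1).
set f := kron (delta_mx 0 ord0 : 'rV[{poly K}]_k.+1) (delta_mx 0 ord0 : 'rV_n.+1).
have DB : D *m B = p ^+ k.+1 *: e by exact: char_poly_mx_state_col.
have CD : C *m D = p ^+ k.+1 *: f by exact: state_row_char_poly_mx.
have [Y DY] : exists Y, e *m C - 1%:M = D *m Y.
  (* Both [e *m C *m D] and [D *m B *m f] equal [p ^+ k.+1 *: (e *m f)]. *)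
  apply: (@hessenberg_div _ _ _ (B *m f - 1%:M)).
  - exact: jacobson_superdiag.
  - exact: jacobson_above_superdiag.
  - rewrite -/D mulmxBl [D *m (_ - _)]mulmxBr mul1mx mulmx1 -mulmxA CD mulmxA DB.
    by rewrite -scalemxAr -scalemxAl.
  (* The last entry of [C] is 1, so the last column of [e *m C] is the last basis vector and the
     difference with the identity vanishes there. *)
  - move=> j j_last; exists 0; rewrite mulmx0; apply/colP=> a.
    have [j_div j_mod] : (j %/ n.+1 = k /\ j %% n.+1 = n)%N.
      have := @divmod_succ n.+1 (j %/ n.+1) (j %% n.+1) k.+1 0 (ltn_pmod j (ltn0Sn n)) (ltn0Sn n).
      rewrite addn0 -divn_eq j_last => /(_ erefl) /=.
      by case: eqP => [-> [[<-]]|_ []].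
    rewrite /e /C kron_mul !mxE !big_ord1 !mxE /= !andbT.
    rewrite j_div j_mod subnn expr0 mulr1 drop_poly_monic // mulr1 -natrM.
    rewrite -!val_eqE /= mulnb; apply/eqP; rewrite subr_eq0; apply/eqP.
    congr (nat_of_bool _)%:R; apply/andP/eqP => [[/eqP a_div /eqP a_mod]|->].
      by rewrite (divn_eq a n.+1) (divn_eq j n.+1) a_div a_mod j_div j_mod.
    by rewrite j_div j_mod !eqxx.
exists Y.
have -> : p ^+ k.+1 *: (\adj D + \det D *: Y) = \adj D *m D *m (B *m C).
  rewrite -mulmxA [D *m _]mulmxA DB -scalemxAl -scalemxAr; congr (_ *: _).
  rewrite -[e *m C](subrK 1%:M) DY mulmxDr mulmx1 mulmxA mul_adj_mx mul_scalar_mx.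
  exact: addrC.
by rewrite mul_adj_mx mul_scalar_mx.
Qed.

(** * Truncated p-adic expansions as matrix products *)

Lemma padic_trunc q n k p (h : 'cV[{poly K}]_q) hs : padic_exp n p h hs ->
  exists u, h = \sum_(i < k) p ^+ i *: hs i + p ^+ k *: u.
Proof.
case=> _ [N [hs0 ->]]; exists (\sum_(i < N) p ^+ i *: hs (k + i)%N).
(* Padding with [k] zero terms allows splitting at [k] even when [N] is smaller. *)
have -> : \sum_(i < N) p ^+ i *: hs i = \sum_(i < N + k) p ^+ i *: hs i.
  rewrite big_split_ord /= [X in _ + X]big1 ?addr0 // => i _.
  by rewrite hs0 ?leq_addr // scaler0.
rewrite addnC big_split_ord scaler_sumr; congr (_ + _).
by apply: eq_bigr => i _; rewrite scalerA exprD.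
Qed.

Lemma Hblock_state_col q n k p (hs : nat -> 'cV[{poly K}]_q) Hs :
  (forall i, hs i = map_mx polyC (Hs i) *m bvec K n) ->
  map_mx polyC (Hblock k Hs) *m state_col n k p = \sum_(i < k) p ^+ i *: hs i.
Proof.
move=> Hs_def; apply/matrixP=> r c; rewrite summxE mxE.
under eq_bigr do rewrite !mxE.
rewrite (sum_blk (fun (i : 'I_k) (j : 'I_n) => (Hs i r j)%:P * (p ^+ i * 'X^j))).
apply: eq_bigr => i _; rewrite Hs_def !mxE mulr_sumr; apply: eq_bigr => j _.
by rewrite !mxE mulrCA.
Qed.

Lemma state_row_Gblock t n k p (gs : nat -> 'cV[{poly K}]_t) Gs :
  p \is monic -> size p = n.+1 ->
  (forall i, gs i = map_mx polyC (Gs i) *m map_mx polyC (hankelM n p) *m bvec K n) ->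
  state_row n k p *m map_mx polyC (Gblock k Gs) = (\sum_(i < k) p ^+ i *: gs i)^T.
Proof.
move=> pm ps Gs_def; apply/matrixP=> r c; rewrite !mxE summxE.
under eq_bigr do rewrite !mxE.
rewrite (sum_blk (fun (i : 'I_k) (j : 'I_n) =>
  p ^+ (k.-1 - i) * drop_poly j.+1 p * (Gs (k.-1 - i)%N c j)%:P)).
rewrite [RHS](reindex_inj rev_ord_inj) /=; apply: eq_bigr => i _.
rewrite -subn1 -subnDA add1n Gs_def -mulmxA hankelM_bvec // !mxE mulr_sumr.
by apply: eq_bigr => j _; rewrite !mxE -mulrA [X in _ * X]mulrC.
Qed.

(** * Transfer functions as quotients of polynomials *)

Lemma size_cofactor_char_poly_mx m (F : 'M[K]_m) i j :
  (size (cofactor (char_poly_mx F) i j) <= m)%N.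
Proof.
case: m F i j => [|m] F i j; first by case: i.
rewrite /cofactor -signr_odd mulr_sign.
suff: (size (\det (row' i (col' j (char_poly_mx F)))) <= m.+1)%N.
  by case: odd; rewrite ?size_polyN.
rewrite /determinant (leq_trans (size_sum _ _ _)) //; apply/bigmax_leqP=> s _.
set P := \prod_l _; suff le_P : (size P <= m.+1)%N.
  by rewrite -signr_odd mulr_sign; case: odd; rewrite ?size_polyN.
apply: leq_trans (size_poly_prod_leq _ _) _.
rewrite leq_subLR card_ord addnS ltnS.
(* A product of [m] factors of size at most 2 has size at most [m.+1]. *)
have -> : (m + m = \sum_(l < m) 2)%N by rewrite sum_nat_const card_ord muln2 addnn.
apply: leq_sum => l _; rewrite !mxE (leq_trans (size_polyD _ _)) // geq_max.
rewrite size_polyN size_polyC (leq_trans (leq_b1 _)) // andbT.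
by case: eqP => _; rewrite ?mulr1n ?mulr0n ?size_polyX ?size_poly0.
Qed.

Definition num_mx q t m (F : 'M[K]_m) (G : 'M[K]_(m, t)) (H : 'M[K]_(q, m)) :=
  map_mx polyC H *m \adj (char_poly_mx F) *m map_mx polyC G.

Lemma size_num_mx q t m (F : 'M[K]_m) (G : 'M[K]_(m, t)) (H : 'M[K]_(q, m)) r c :
  (size (num_mx F G H r c) <= m)%N.
Proof.
rewrite !mxE (leq_trans (size_sum _ _ _)) //; apply/bigmax_leqP=> j _.
rewrite !mxE mulrC mul_polyC (leq_trans (size_scale_leq _ _)) //.
rewrite (leq_trans (size_sum _ _ _)) //; apply/bigmax_leqP=> i _.
rewrite !mxE mul_polyC (leq_trans (size_scale_leq _ _)) //.
exact: size_cofactor_char_poly_mx.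
Qed.

Lemma char_poly_neq0 m (F : 'M[K]_m) : char_poly F != 0.
Proof. exact/monic_neq0/char_poly_monic. Qed.

Lemma transferE q t m (F : 'M[K]_m) (G : 'M[K]_(m, t)) (H : 'M[K]_(q, m)) r c :
  transfer F G H r c = tofrac (num_mx F G H r c) / tofrac (char_poly F).
Proof.
have svarE : (svar K)%:M - map_mx (@cst K) F = map_mx (@tofrac _) (char_poly_mx F).
  by apply/matrixP=> i j; rewrite !mxE rmorphB rmorphMn.
have cstE m' n' (A : 'M[K]_(m', n')) : map_mx (@cst K) A = map_mx (@tofrac _) (map_mx polyC A).
  by apply/matrixP=> i j; rewrite !mxE.
(* Needed because [invmx] is the inverse only on units; on them it is the adjugate over the
   determinant. *)
have unitD : map_mx (@tofrac _) (char_poly_mx F) \in unitmx.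
  by rewrite unitmxE det_map_mx unitfE tofrac_eq0 char_poly_neq0.
rewrite /transfer svarE !cstE /invmx unitD det_map_mx -map_mx_adj.
by rewrite -scalemxAr -scalemxAl -!map_mxM !mxE mulrC.
Qed.

Lemma frac_split a b x d y : b != 0 -> d != 0 ->
  (tofrac a / tofrac b == tofrac x / tofrac d + tofrac y) = (d * a == b * (x + d * y)).
Proof.
move=> b0 d0; rewrite div_eq_divD ?tofrac_eq0 // -[RHS]tofrac_eq.
by rewrite [in RHS]tofracM [in RHS]tofracM tofracD tofracM.
Qed.

Lemma WmxE q t k p (h : 'cV[{poly K}]_q) (g : 'cV[{poly K}]_t) r c :
  Wmx k p h g r c = tofrac (h r 0 * g c 0) / tofrac (p ^+ k).
Proof. by rewrite !mxE big_ord1 !mxE rmorphM mulrC. Qed.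

(** Otherwise [p] itself would be a nonconstant common divisor. *)
Lemma coprime_vec_ndvd q p (h : 'cV[{poly K}]_q) :
  irreducible_poly p -> coprime_vec p h -> exists r, ~~ (p %| h r 0).
Proof.
move=> [p_gt1 _] cop; apply/existsP; rewrite -negb_forall; apply/negP=> /forallP p_h.
by have := cop p (dvdpp p) p_h; rewrite leqNgt p_gt1.
Qed.

End Realization.

Theorem theorem4p1 (K : fieldType) (n : nat) (p : {poly K})
  (p_monic : p \is monic) (p_irr : irreducible_poly p) (p_size : size p = n.+1)
  (k : nat) (k_pos : (0 < k)%N) (q t : nat)
  (h : 'cV[{poly K}]_q) (g : 'cV[{poly K}]_t)
  (cop_h : coprime_vec p h) (cop_g : coprime_vec p g)
  (hs : nat -> 'cV[{poly K}]_q) (gs : nat -> 'cV[{poly K}]_t)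
  (hs_exp : padic_exp n p h hs) (gs_exp : padic_exp n p g gs)
  (Hs : nat -> 'M[K]_(q, n)) (Gs : nat -> 'M[K]_(t, n))
  (Hs_def : forall i, hs i = map_mx polyC (Hs i) *m bvec K n)
  (Gs_def : forall i, gs i = map_mx polyC (Gs i) *m map_mx polyC (hankelM n p) *m bvec K n) :
  pim_mx (Wmx k p h g)
    (transfer (jacobson n k p) (Gblock k Gs) (Hblock k Hs))
  /\ ~ (exists (m : nat) (F' : 'M[K]_m) (G' : 'M[K]_(m, t)) (H' : 'M[K]_(q, m)),
          (m < k * n)%N /\ pim_mx (Wmx k p h g) (transfer F' G' H')).
Proof.
have pk0 : p ^+ k != 0 by rewrite expf_neq0 // monic_neq0.
split; last first.
  case=> m [F [G [H [lt_m piW]]]].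
  have [r p_h] := coprime_vec_ndvd p_irr cop_h.
  have [c p_g] := coprime_vec_ndvd p_irr cop_g.
  have [_ [y /eqP]] := piW r c.
  rewrite WmxE transferE frac_split ?char_poly_neq0 // => /eqP eqW.
  (* Gauss's lemma removes the factors prime to [p]; comparing degrees then gives [k * n <= m]. *)
  have pk_dvd : p ^+ k %| char_poly F.
    have: p ^+ k %| char_poly F * (h r 0 * g c 0) by rewrite eqW dvdp_mulr.
    by rewrite mulrA !Gauss_dvdpl ?coprimep_expl ?irreducible_poly_coprime.
  have := dvdp_leq (char_poly_neq0 F) pk_dvd; rewrite size_char_poly.
  move=> le_pk; move: lt_m; rewrite ltnNge => /negP; apply.
  by rewrite -[n]/(n.+1.-1) -p_size mulnC -size_exp -subn1 leq_subLR add1n.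
case: k k_pos pk0 => // k _ pk0.
case: n p_size hs_exp gs_exp Hs Gs Hs_def Gs_def => [|n] ps hs_exp gs_exp Hs Gs Hs_def Gs_def.
  by case: p_irr; rewrite ps.
move=> r c; set J := jacobson _ _ _.
rewrite /pim WmxE transferE; split.
  have [-> | x0] := eqVneq (num_mx J (Gblock k.+1 Gs) (Hblock k.+1 Hs) r c) 0.
    by left; rewrite rmorph0 mul0r.
  right; exists (num_mx J (Gblock k.+1 Gs) (Hblock k.+1 Hs) r c), (char_poly J).
  by rewrite mulf_neq0 ?char_poly_neq0 // size_char_poly ltnS size_num_mx.
have [u h_eq] := padic_trunc k.+1 hs_exp.
have [v g_eq] := padic_trunc k.+1 gs_exp.
have [Y BC] := state_col_row k p_monic ps.
rewrite -(Hblock_state_col _ _ Hs_def) in h_eq.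
have {}g_eq := congr1 trmx g_eq.
rewrite linearD linearZ /= -(state_row_Gblock _ p_monic ps Gs_def) in g_eq.
move: BC; rewrite -/J -/(char_poly J) => BC.
set B := state_col _ _ _ in BC h_eq; set C := state_row _ _ _ in BC g_eq.
set HH := map_mx _ _ in h_eq; set GG := map_mx _ _ in g_eq.
(* Expanding h and then g transposed modulo [p ^+ k.+1] gives the last two terms; [Y] comes from
   replacing [B *m C] by the resolvent. *)
exists ((HH *m Y *m GG + (HH *m B *m v^T + u *m g^T)) r c).
apply/eqP; rewrite frac_split ?char_poly_neq0 //; apply/eqP.
have -> : h r 0 * g c 0 = (h *m g^T) r c by rewrite mxE big_ord1 mxE.
have hgT : h *m g^T = HH *m (B *m C) *m GG + p ^+ k.+1 *: (HH *m B *m v^T + u *m g^T).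
  rewrite {1}h_eq mulmxDl {1}g_eq mulmxDr -!scalemxAl -!scalemxAr scalerDr addrA.
  by rewrite !mulmxA.
suff : char_poly J *: (h *m g^T) = p ^+ k.+1 *:
   (num_mx J (Gblock k.+1 Gs) (Hblock k.+1 Hs)
    + char_poly J *: (HH *m Y *m GG + (HH *m B *m v^T + u *m g^T))).
  by move/matrixP/(_ r c); rewrite !mxE.
rewrite hgT [_ *: (_ + _ *: _)]scalerDr scalemxAl scalemxAr BC.
rewrite -scalemxAr -scalemxAl scalerA [char_poly J * _]mulrC -scalerA -scalerDr.
congr (_ *: _); rewrite mulmxDr mulmxDl -scalemxAr -scalemxAl scalerDr addrA.
by rewrite /num_mx !scalerDr !addrA.
Qed.
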